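(* Fix $L>0$ and $\delta\in(0,1)$. There is no real number $\eta_{\max}=\eta_{\max}(\delta,L)>0$ with the following property: for every convex $L$-smooth quadratic function $f:\mathbb{R}\to\mathbb{R}$, every $x_0\neq 0$, every stepsize $\eta$ with $0<\eta\le\eta_{\max}$, and every noise sequence $(e_n)_{n\ge 0}$ in $\mathbb{R}$ such that the iterates defined by $x_{n+1}=x_n-\eta\,(\nabla f(x_n)+e_n)$, $n\ge 0$, satisfy $|e_n|\le\delta\,|\nabla f(x_n)|$ for all $n\ge 0$, the optimization curve $\{f(x_n)\}_{n\ge0}$ is convex.
   Context: A differentiable function $f$ is $L$-smooth if its gradient is Lipschitz continuous with constant $L$. In one dimension $\nabla f=f'$. A real sequence $\{a_n\}_{n\ge0}$ is called convex if $a_{n+1}-a_n\le a_{n+2}-a_{n+1}$ for all $n\ge0$. The optimization curve of an iteration $(x_n)_{n\ge 0}$ is the real sequence $\{f(x_n)\}_{n\ge0}$. *)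

(* Defs.v *)
From HB Require Import structures.
From mathcomp Require Import all_boot all_order all_algebra.
From mathcomp Require Import all_classical all_reals all_analysis.

Set Implicit Arguments.
Unset Strict Implicit.
Unset Printing Implicit Defensive.

Import Order.TTheory GRing.Theory Num.Theory.
Import numFieldNormedType.Exports.

Local Open Scope ring_scope.
Local Open Scope classical_set_scope.

(* The leading coefficient is required to be nonzero: affine functions are
   not counted as quadratic. The minimizer and the minimum are arbitrary. *)
Definition quadratic (R : realType) (f : R -> R) : Prop :=
  exists a b c : R, a != 0 /\ forall x, f x = a * x ^+ 2 + b * x + c.

Definition smooth (R : realType) (L : R) (f : R -> R) : Prop :=
  (forall x : R, derivable f x 1) /\ L.-lipschitz (derive1 f).

(* R^o is R seen as a module over itself, as convex_function expects. *)
Definition convex_fun (R : realType) (f : R -> R) : Prop :=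
  convex_function (setT : set R^o) f.

Definition convex_seq (R : realType) (a : nat -> R) : Prop :=
  forall n : nat, a n.+1 - a n <= a n.+2 - a n.+1.

Fixpoint noisy_gd (R : realType) (f : R -> R) (eta x0 : R) (e : nat -> R)
    (n : nat) : R :=
  if n is m.+1 then
    let x := noisy_gd f eta x0 e m in x - eta * (derive1 f x + e m)
  else x0.

(* Main.v *)
Require Import Defs.
From HB Require Import structures.
From mathcomp Require Import all_boot all_order all_algebra ring lra.
From mathcomp Require Import all_classical all_reals all_analysis.
Import Order.TTheory GRing.Theory Num.Theory.
Import numFieldNormedType.Exports.
Local Open Scope ring_scope.
Local Open Scope classical_set_scope.

(** On f x = L / 2 * x ^ 2 started at 1, take first the shortest step allowed by
the noise (factor 1 - t (1 - delta) with t = eta L) and then the longest one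
(factor 1 - t (1 + delta)). To first order in t the two decreases of f are
L t (1 - delta) and L t (1 + delta), so for small t the second one is the
larger, against convexity of the curve. Taking t <= delta / 4 is enough. *)

Lemma is_derive_scaled_sqr (R : realType) (a x : R) :
  is_derive x 1 (fun y : R => a * y ^+ 2) (2 * a * x).
Proof.
apply: is_derive_eq.
rewrite /GRing.scale /=; ring.
Qed.

Lemma derive1_scaled_sqr (R : realType) (a x : R) :
  derive1 (fun y : R => a * y ^+ 2) x = 2 * a * x.
Proof. by rewrite derive1E; case: (is_derive_scaled_sqr R a x). Qed.

Lemma smooth_scaled_sqr (R : realType) (a : R) :
  0 <= a -> smooth (2 * a) (fun y : R => a * y ^+ 2).
Proof.
move=> a0; split; first by move=> x; case: (is_derive_scaled_sqr R a x).
move=> [x y] _ /=.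
by rewrite !derive1_scaled_sqr -mulrBr normrM [`|2 * a|]ger0_norm// mulr_ge0.
Qed.

Lemma convex_scaled_sqr (R : realType) (a : R) :
  0 <= a -> convex_fun (fun y : R => a * y ^+ 2).
Proof.
move=> a0 t x y _ _.
have t0 : 0 <= t%:num by [].
have t1 : t%:num <= 1 by [].
set s := t%:num in t0 t1.
(* The convex combination over [R^o] unfolds to ordinary arithmetic in [R]; the convexity gap is
   then a multiple of a square. *)
change (a * (s * x + (1 - s) * y) ^+ 2 <=
  s * (a * x ^+ 2) + (1 - s) * (a * y ^+ 2) :> R).
rewrite -subr_ge0.
have -> : s * (a * x ^+ 2) + (1 - s) * (a * y ^+ 2)
    - a * (s * x + (1 - s) * y) ^+ 2 = a * (s * (1 - s)) * (x - y) ^+ 2 :> R.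
  by ring.
apply: mulr_ge0; last exact: sqr_ge0.
by rewrite !mulr_ge0 ?subr_ge0.
Qed.

(** Both decreases are multiples of [t]. After dividing by [t], their difference is at least
    [(2 - 6 * t) * (1 + d) - 2 * (1 - d)], which exceeds [4 * d - 12 * t >= d]. *)
Lemma short_long_step_decrease (R : realFieldType) (t d : R) :
  0 < t -> 0 < d -> d < 1 -> 4 * t <= d ->
  1 - (1 - t * (1 - d)) ^+ 2 <
  (1 - t * (1 - d)) ^+ 2 - ((1 - t * (1 - d)) * (1 - t * (1 + d))) ^+ 2.
Proof.
move=> t0 d0 d1 td.
rewrite -subr_gt0.
set u := t * (1 - d); set v := t * (1 + d).
have -> : (1 - u) ^+ 2 - ((1 - u) * (1 - v)) ^+ 2 - (1 - (1 - u) ^+ 2) =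
    t * ((1 - u) ^+ 2 * (1 + d) * (2 - v) - (1 - d) * (2 - u)).
  by rewrite /u /v; ring.
apply: mulr_gt0 => //.
have u0 : 0 <= u by rewrite mulr_ge0; lra.
have ut : u <= t by rewrite ger_pMr; lra.
have vt : v <= 2 * t by rewrite /v; nra.
have u2 : 1 - 2 * t <= (1 - u) ^+ 2 by nra.
have p1 : 2 - 6 * t <= (1 - u) ^+ 2 * (2 - v).
  (* The factors are bounded separately; [4 * t <= d < 1] keeps both lower bounds nonnegative, so
     they multiply. *)
  apply: (@le_trans _ _ ((1 - 2 * t) * (2 - 2 * t))); first by nra.
  by apply: ler_pM => //; lra.
have p2 : (2 - 6 * t) * (1 + d) <= (1 - u) ^+ 2 * (2 - v) * (1 + d).
  by rewrite ler_wpM2r//; lra.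
have p3 : (1 - d) * (2 - u) <= (1 - d) * 2 by rewrite ler_wpM2l; lra.
have p4 : t * d < t by rewrite gtr_pMr.
rewrite mulrAC; lra.
Qed.

Theorem theorem2p1 (R : realType) (L delta : R)
    (L_gt0 : 0 < L) (delta_gt0 : 0 < delta) (delta_lt1 : delta < 1) :
  ~ exists eta_max : R, 0 < eta_max /\
      forall (f : R -> R) (x0 eta : R) (e : nat -> R),
        quadratic f -> convex_fun f -> smooth L f ->
        x0 <> 0 ->
        0 < eta -> eta <= eta_max ->
        (forall n : nat,
           `|e n| <= delta * `|derive1 f (noisy_gd f eta x0 e n)|) ->
        convex_seq (fun n => f (noisy_gd f eta x0 e n)).
Proof.
move=> [eta_max [eta_max_gt0 curve_convex]].
pose f (x : R) := L / 2 * x ^+ 2.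
(* The second bound gives [4 * (eta * L) <= delta]. *)
pose eta := Num.min eta_max (delta / (4 * L)).
pose x1 := 1 - eta * L * (1 - delta).
(* The noise is [- delta] times the gradient at 1, then [delta] times the gradient at [x1],
   saturating the bound both times. It is zero afterwards, since only the first three iterates
   matter. *)
pose e n := if n is m.+1 then (if m is 0 then delta * (L * x1) else 0)
            else - (delta * L).
have L2 : 2 * (L / 2) = L by field.
have L2_ge0 : 0 <= L / 2 by rewrite divr_ge0// ltW.
have f'E x : derive1 f x = L * x by rewrite derive1_scaled_sqr L2.
have eta_gt0 : 0 < eta by rewrite lt_min eta_max_gt0 divr_gt0 ?mulr_gt0.
have eta_le : eta <= eta_max by rewrite ge_min lexx.
have eta_small : 4 * (eta * L) <= delta.
  have : eta <= delta / (4 * L) by rewrite ge_min lexx orbT.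
  by rewrite ler_pdivlMr ?mulr_gt0// mulrCA.
have gd1 : noisy_gd f eta 1 e 1 = x1 by rewrite /= f'E /x1; ring.
have gd2 : noisy_gd f eta 1 e 2 = x1 * (1 - eta * L * (1 + delta)).
  have -> : noisy_gd f eta 1 e 2 = noisy_gd f eta 1 e 1 -
      eta * (derive1 f (noisy_gd f eta 1 e 1) + e 1) by [].
  by rewrite gd1 f'E /=; ring.
have noise n : `|e n| <= delta * `|derive1 f (noisy_gd f eta 1 e n)|.
  case: n => [|[|n]].
  - by rewrite /= f'E mulr1 normrN normrM (gtr0_norm delta_gt0).
  - by rewrite gd1 f'E /= normrM (gtr0_norm delta_gt0).
  - by rewrite normr0 mulr_ge0 // ltW.
have quad : quadratic f.
  exists (L / 2), 0, 0; split=> [|x]; first by rewrite gt_eqF// divr_gt0.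
  by rewrite mul0r !addr0.
have fL : smooth L f by rewrite -{1}L2; exact: smooth_scaled_sqr.
have /(_ 0) := curve_convex f 1 eta e quad (convex_scaled_sqr _ _ L2_ge0) fL
  (elimN eqP (oner_neq0 R)) eta_gt0 eta_le noise.
(* Cancelling [L / 2] leaves the convexity inequality at index 0, whose negation is the lemma with
   [t = eta * L]. *)
rewrite gd1 gd2 /= /f -!mulrBr ler_pM2l ?divr_gt0// expr1n.
have := short_long_step_decrease R (eta * L) delta (mulr_gt0 eta_gt0 L_gt0)
  delta_gt0 delta_lt1 eta_small.
rewrite -/x1; lra.
Qed.
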